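(* Let $(W,S)$ be a finitely generated Coxeter system (not necessarily finite) and $A\subseteq T$. Assume one of the following holds: (1) there exist subsets $S_1,S_2\subseteq S$ with $A=S_1\cup\bigl(\bigcup_{s\in S_2}C(s)\bigr)$, where $C(s)$ is the conjugacy class of $s$ in $W$; (2) $S=\{s,t\}$, the order $m(s,t)$ of $st$ is even or $\infty$, and $A=\{s,t,sts\}$ or $A=\{t,sts\}$. Then $A$ is nice.
   Context: $\ell$ is the length function, $T=\{wsw^{-1}\mid w\in W,s\in S\}$ is the set of reflections. For $A\subseteq T$ and $w\in W$, $D_A(w)=\{r\in A\mid \ell(wr)<\ell(w)\}$. A subset $A\subseteq T$ is called nice if for every $r\in A$ and every $w\in W$ with $w^{-1}rw\notin A$, one has $D_A(rw)=D_A(w)$. *)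

(* Defs.v *)
From HB Require Import structures.
From mathcomp Require Import all_boot.
From mathcomp Require Import boolp classical_sets functions cardinality.

Set Implicit Arguments.
Unset Strict Implicit.
Unset Printing Implicit Defensive.

Local Open Scope classical_set_scope.
Local Open Scope group_scope.

Definition has_order (G : groupType) (x : G) (n : nat) : Prop :=
  [/\ (0 < n)%N, x ^+ n = 1 & forall k, (0 < k < n)%N -> x ^+ k <> 1].

Definition has_infinite_order (G : groupType) (x : G) : Prop :=
  forall n, (0 < n)%N -> x ^+ n <> 1.

Section Coxeter.
Variables (W : groupType) (S : set W).

(* [w] is a product of [k] elements of [S]; inverses of generators are not
   needed because the elements of [S] will be involutions. *)
Definition has_word (w : W) (k : nat) : Prop :=
  exists ws : seq W,
    [/\ [set` ws] `<=` S, size ws = k & w = \prod_(x <- ws) x].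

(* (W, S) is a Coxeter system: W is the group presented by the generating set S
   of involutions, subject to the relations (s t)^m(s,t) = 1 for those s, t in S
   such that the order m(s,t) of s t is finite. The presentation is stated by
   its universal property; uniqueness of [phi] follows from generation. *)
Record coxeter_system : Prop := CoxeterSystem {
  coxeter_involution : forall s, S s -> has_order s 2;
  coxeter_generated : forall w, exists k, has_word w k;
  coxeter_presented :
    forall (G : groupType) (f : W -> G),
      (forall s t m, S s -> S t -> has_order (s * t) m ->
         (f s * f t) ^+ m = 1) ->
      exists phi : {multiplicative W -> G}, forall s, S s -> phi s = f s }.

(* The default value 0 is never used when [S] generates [W]. *)
Definition coxeter_length (w : W) : nat :=
  if pselect (exists k, `[< has_word w k >]) is left e then ex_minn e else 0.

Definition reflections : set W :=
  [set r | exists w s, S s /\ r = w * s * w^-1].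

Definition descents (A : set W) (w : W) : set W :=
  [set r | A r /\ (coxeter_length (w * r) < coxeter_length w)%N].

Definition nice (A : set W) : Prop :=
  A `<=` reflections /\
  forall r w, A r -> ~ A (w^-1 * r * w) -> descents A (r * w) = descents A w.

End Coxeter.

Definition conj_class (W : groupType) (x : W) : set W :=
  [set w * x * w^-1 | w in setT].

(* Main.v *)
Require Import Defs.
From HB Require Import structures.
From mathcomp Require Import all_boot.
From mathcomp Require Import boolp classical_sets functions cardinality.

Local Open Scope classical_set_scope.
Local Open Scope group_scope.

Set Implicit Arguments.
Unset Strict Implicit.

(** The universal property, applied to the semidirect product of [W] with
    [W -> bool], yields the reflection cocycle [eta]: [eta w x] is the parity of
    the number of occurrences of [x] among the reflections
    [s1 ... si ... s1] of a word [s1 ... sk] for [w], and on reflections it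
    detects [l(x w) < l(w)].  Since
    [eta (r w) (r y r^-1) = eta r (r y r^-1) + eta w y], niceness of [A] amounts to
    [eta r] vanishing at [w q w^-1] for [q, r] in [A] with [w^-1 r w] outside [A].
    For simple [r] the only zero to exclude is [w q w^-1 = r].  For [r = sts] with
    [st] of even or infinite order, [eta r] is supported on [s], [sts], [ststs];
    [s] and [t] are not conjugate, and an element commuting with [s] is central up
    to a factor [s]. *)

Lemma conjg_eq (G : groupType) (x y z : G) : (x ^ z == y) = (x == z * y * z^-1).
Proof.
apply/eqP/eqP => [<-|->]; rewrite conjgE.
  by rewrite mulgA mulgA mulgV mul1g mulgK.
by rewrite mulgVK mulKg.
Qed.

Lemma multiplicative1 (G H : groupType) (phi : {multiplicative G -> H}) :
  phi 1 = 1.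
Proof. by apply: (mulgI (phi 1)); rewrite -gmulfM !mulg1. Qed.

(** * The semidirect product of [W] with the functions [W -> bool] *)

Definition twisted (W : groupType) : Type := W * (W -> bool).

Section Twisted.
Variable W : groupType.

HB.instance Definition _ := Choice.on (twisted W).

(** [W] acts on functions by conjugating the argument; [x ^ u] is [u^-1 * x * u]. *)
Definition twisted_mul (a b : twisted W) : twisted W :=
  (a.1 * b.1, fun x => a.2 x (+) b.2 (x ^ a.1)).
Definition twisted_one : twisted W := (1, fun=> false).
Definition twisted_inv (a : twisted W) : twisted W :=
  (a.1^-1, fun x => a.2 (x ^ a.1^-1)).

Lemma twisted_mulA : associative twisted_mul.
Proof.
move=> [u f] [v g] [w h]; rewrite /twisted_mul /= mulgA; congr pair.
by apply/funext => x; rewrite conjgM addbA.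
Qed.

Lemma twisted_mul1g : left_id twisted_one twisted_mul.
Proof.
move=> [u f]; rewrite /twisted_mul /= mul1g; congr pair.
by apply/funext => x; rewrite conjg1.
Qed.

Lemma twisted_mulg1 : right_id twisted_one twisted_mul.
Proof.
move=> [u f]; rewrite /twisted_mul /= mulg1; congr pair.
by apply/funext => x; rewrite addbF.
Qed.

Lemma twisted_mulVg : left_inverse twisted_one twisted_inv twisted_mul.
Proof.
move=> [u f]; rewrite /twisted_mul /= mulVg; congr pair.
by apply/funext => x; rewrite addbb.
Qed.

Lemma twisted_mulgV : right_inverse twisted_one twisted_inv twisted_mul.
Proof.
move=> [u f]; rewrite /twisted_mul /= mulgV; congr pair.
by apply/funext => x; rewrite conjgK addbb.
Qed.

HB.instance Definition _ := isGroup.Build (twisted W)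
  twisted_mulA twisted_mul1g twisted_mulg1 twisted_mulVg twisted_mulgV.

Lemma twistedM1 (a b : twisted W) : (a * b).1 = a.1 * b.1.
Proof. by []. Qed.

Lemma twistedM2 (a b : twisted W) x : (a * b).2 x = a.2 x (+) b.2 (x ^ a.1).
Proof. by []. Qed.

Lemma twistedX1 (a : twisted W) n : (a ^+ n).1 = a.1 ^+ n.
Proof. by elim: n => [|n IH] //; rewrite !expgS twistedM1 IH. Qed.

Definition twisted_gen (s : W) : twisted W := (s, fun x => x == s).

(** The reflections attached to the alternating word [s t s t ...] with [2n] letters are [s], [sts],
    [ststs], and so on, that is [(st)^i s]. *)
Lemma twisted_gen_expg s t n x : s * s = 1 -> t * t = 1 ->
  ((twisted_gen s * twisted_gen t) ^+ n).2 x =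
  \big[addb/false]_(0 <= i < n.*2) (x == (s * t) ^+ i * s).
Proof.
move=> ss tt; elim: n => [|n IH]; first by rewrite big_geq.
have sV : s^-1 = s by apply: mulg1_eq.
have tV : t^-1 = t by apply: mulg1_eq.
have ps k : (s * t) ^+ k * s = s * (s * t) ^- k.
  rewrite -expVgn invgM sV tV.
  elim: k => [|k IHk]; first by rewrite !expg0 mulg1 mul1g.
  by rewrite !expgSr !mulgA IHk.
rewrite expgSr twistedM2 IH twistedX1 doubleS !big_nat_recr //= -addbA.
(* The two new letters give the indices [2n] and [2n+1]: by [ps], conjugating by [(st)^n] doubles
   the exponent. *)
congr (_ (+) (_ (+) _)).
  by rewrite conjg_eq -mulgA -ps mulgA -expgnDr addnn.
rewrite (conjg_eq _ t) sV.
by rewrite conjg_eq -!mulgA -ps !mulgA -(mulgA _ s t) -expgSr -expgnDr addSn addnn.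
Qed.

End Twisted.

(** * The reflection cocycle *)

Section Coxeter.
Variables (W : groupType) (S : set W).
Hypothesis hWS : coxeter_system S.

Lemma generator_square s : S s -> s * s = 1.
Proof. by move=> /(coxeter_involution hWS)[_]; rewrite expg2. Qed.

Lemma generator_inv s : S s -> s^-1 = s.
Proof. by move=> /generator_square/mulg1_eq. Qed.

Lemma generated_ind (P : W -> Prop) :
  P 1 -> (forall s w, S s -> P w -> P (s * w)) -> forall w, P w.
Proof.
move=> P1 PM w; have [k [ws [wsS _ ->]]] := coxeter_generated hWS w.
elim: ws wsS => [|s ws IH] wsS; rewrite ?big_nil ?big_cons //.
apply: PM; first by apply: wsS; rewrite /= mem_head.
by apply: IH => x /= xws; apply: wsS; rewrite /= in_cons xws orbT.
Qed.

Lemma reflection_cocycle : exists eta : W -> W -> bool,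
  (forall s x, S s -> eta s x = (x == s)) /\
  (forall u v x, eta (u * v) x = eta u x (+) eta v (x ^ u)).
Proof.
have rel s t m : S s -> S t -> has_order (s * t) m ->
    (twisted_gen s * twisted_gen t) ^+ m = 1.
  move=> /generator_square ss /generator_square tt [_ stm _].
  apply: injective_projections; first by rewrite twistedX1 /= stm.
  apply/funext => x; rewrite twisted_gen_expg //= -addnn.
  (* As [(st)^m = 1], the terms of index [i] and [m + i] coincide and cancel modulo 2. *)
  rewrite (big_cat_nat (leq0n m) (leq_addr m m)) /= -{2}[m]add0n big_addn addnK.
  rewrite [X in _ (+) X](eq_bigr (fun i => x == (s * t) ^+ i * s)) ?addbb //.
  by move=> i _; rewrite expgnDr stm mulg1.
have [phi phiS] := coxeter_presented hWS rel.
have phi1 w : (phi w).1 = w.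
  elim/generated_ind: w => [|s w Ss IH]; first by rewrite multiplicative1.
  by rewrite gmulfM twistedM1 IH phiS.
exists (fun w => (phi w).2); split=> [s x Ss|u v x]; first by rewrite phiS.
by rewrite gmulfM twistedM2 phi1.
Qed.

(** * Length and strong exchange *)

Lemma coxeter_length_word w : has_word S w (coxeter_length S w).
Proof.
rewrite /coxeter_length; case: pselect => [e|[]].
  by case: ex_minnP => k /asboolP.
by have [k wk] := coxeter_generated hWS w; exists k; apply/asboolP.
Qed.

Lemma coxeter_length_le w k : has_word S w k -> (coxeter_length S w <= k)%N.
Proof.
move=> wk; rewrite /coxeter_length; case: pselect => // e.
by case: ex_minnP => j _; apply; apply/asboolP.
Qed.

Lemma reflectionsJ w x : reflections S x -> reflections S (w * x * w^-1).
Proof.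
by move=> [u [s [Ss ->]]]; exists (w * u), s; rewrite invgM !mulgA.
Qed.

Section Cocycle.
Variable eta : W -> W -> bool.
Hypothesis etaS : forall s x, S s -> eta s x = (x == s).
Hypothesis etaM : forall u v x, eta (u * v) x = eta u x (+) eta v (x ^ u).

Lemma eta1 x : eta 1 x = false.
Proof. by have := etaM 1 1 x; rewrite mul1g conjg1 addbb. Qed.

Lemma etaV u x : eta u^-1 (x ^ u) = eta u x.
Proof. by have := etaM u u^-1 x; rewrite mulgV eta1; case: eta; case: eta. Qed.

Lemma reflection_square x : reflections S x -> x * x = 1.
Proof.
move=> [u [s [Ss ->]]].
by rewrite !mulgA mulgVK -(mulgA u) generator_square // mulg1 mulgV.
Qed.

(** For [x = u s u^-1] the contributions of [u] and [u^-1] cancel, leaving [eta s s]. *)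
Lemma eta_reflection x : reflections S x -> eta x x.
Proof.
move=> [u [s [Ss xE]]]; have xu : x ^ u = s.
  by rewrite conjgE xE !mulgA mulVg mul1g mulgVK.
have ssE : s ^ s = s by rewrite conjgE mulgA mulVg mul1g.
rewrite {1}xE -mulgA etaM xu etaM (etaS _ Ss) eqxx ssE.
by rewrite -xu etaV addbC -addbA addbb.
Qed.

(** Odd parity forces [x] to occur among the reflections of the word, and multiplying by [x] deletes
    the matching letter. If [x] is the first letter, drop it; otherwise recurse on the tail with
    [x ^ s] and put [s] back in front. *)
Lemma strong_exchange ws x : [set` ws] `<=` S -> eta (\prod_(y <- ws) y) x ->
  exists k, (k < size ws)%N /\ has_word S (x * \prod_(y <- ws) y) k.
Proof.
elim: ws x => [|s ws IH] x wsS; first by rewrite big_nil eta1.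
have Ss : S s by apply: wsS; rewrite /= mem_head.
have {}wsS : [set` ws] `<=` S.
  by move=> y /= yws; apply: wsS; rewrite /= in_cons yws orbT.
rewrite big_cons etaM etaS //; case: eqVneq => [-> _|_ /= /(IH _ wsS)].
  exists (size ws); split=> //; exists ws; split=> //.
  by rewrite mulgA generator_square // mul1g.
move=> [k [kws [vs [vsS vsk vsE]]]]; exists k.+1; split=> //.
exists (s :: vs); split; first by move=> y /=; rewrite in_cons => /predU1P[->|/vsS].
  by rewrite /= vsk.
by rewrite big_cons -vsE conjgE -mulgA !mulgA mulgV mul1g.
Qed.

Lemma eta_length_lt w x : eta w x ->
  (coxeter_length S (x * w) < coxeter_length S w)%N.
Proof.
have [ws [wsS <- {1 2}->]] := coxeter_length_word w.
move=> /(strong_exchange wsS)[k [kws wk]].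
exact: leq_ltn_trans (coxeter_length_le wk) kws.
Qed.

Lemma coxeter_length_lt w x : reflections S x ->
  (coxeter_length S (x * w) < coxeter_length S w)%N = eta w x.
Proof.
move=> Tx; apply/idP/idP; last exact: eta_length_lt.
apply: contraTT => etawx; rewrite -leqNgt ltnW //.
have xx : x ^ x = x by rewrite conjgE mulgA mulVg mul1g.
(* Since [eta x x] is true, passing from [w] to [x w] flips the parity at [x], so here [x] shortens
   [x w] to [w]. *)
have /eta_length_lt : eta (x * w) x.
  by rewrite etaM xx eta_reflection //= (negPf etawx).
by rewrite mulgA reflection_square // mul1g.
Qed.

(** * Niceness from the vanishing of the cocycle *)

Lemma niceI A : A `<=` reflections S ->
  (forall r w q, A r -> A q -> ~ A (w^-1 * r * w) ->
     eta r (w * q * w^-1) = false) ->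
  nice S A.
Proof.
move=> AT eta0; split=> // r w Ar NAr.
(* Right multiplication of [v] by [q] is left multiplication by [v q v^-1]. *)
have lenE v q : A q ->
    (coxeter_length S (v * q) < coxeter_length S v)%N = eta v (v * q * v^-1).
  by move=> /AT Tq; rewrite -coxeter_length_lt ?mulgVK //; apply: reflectionsJ.
have descE q : A q -> (coxeter_length S (r * w * q) < coxeter_length S (r * w))%N =
    (coxeter_length S (w * q) < coxeter_length S w)%N.
  move=> Aq; rewrite !lenE // etaM.
  have -> : r * w * q * (r * w)^-1 = (w * q * w^-1) ^ r^-1.
    by rewrite conjgE invgK invgM !mulgA.
  (* As [r] is an involution, [eta r] takes the same value at [y] and at [r y r^-1]. *)
  rewrite conjgKV -etaV conjgKV (mulg1_eq (reflection_square (AT _ Ar))).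
  by rewrite eta0.
by apply/seteqP; split=> q [Aq lt_q]; split=> //; move: lt_q; rewrite descE.
Qed.

(** Conjugacy classes are stable, so an [r] with a conjugate outside [A] lies in [S1] and is
    simple. *)
Lemma nice_conj_classes S1 S2 A : A `<=` reflections S -> S1 `<=` S ->
  A = S1 `|` \bigcup_(s in S2) conj_class s -> nice S A.
Proof.
move=> AT S1S AE; apply: niceI => // r w q Ar Aq NAr.
have S1r : S1 r.
  move: Ar; rewrite AE => -[//|[s S2s [u _ rE]]]; exfalso; apply: NAr.
  rewrite AE; right; exists s => //; exists (w^-1 * u) => //.
  by rewrite -rE invgM invgK !mulgA.
rewrite etaS; last exact: S1S.
apply/negP => /eqP rE; apply: NAr.
by rewrite -rE !mulgA mulVg mul1g mulgVK.
Qed.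

(** * Two generators with product of even or infinite order *)

Section Dihedral.
Variables s t : W.
Hypothesis SE : S = [set s; t].

(** [a] is the rotation part of [w]; all that is recorded of it is that both generators invert
    it. *)
Lemma dihedral_form w : exists a,
  [/\ s * a * s = a^-1, t * a * t = a^-1 & w = a \/ w = a * s].
Proof.
have Ss : S s by rewrite SE; left.
have St : S t by rewrite SE; right.
have sK x : x * s * s = x by rewrite -mulgA generator_square // mulg1.
have tK x : x * t * t = x by rewrite -mulgA generator_square // mulg1.
have flip (x a : W) : x * x = 1 -> x * a * x = a^-1 ->
    x * a = a^-1 * x /\ x * a^-1 = a * x.
  move=> xx xa; split; first by rewrite -xa -mulgA xx mulg1.
  by rewrite -xa !mulgA xx mul1g.
elim/generated_ind: w => [|x w Sx [a [sa ta wE]]].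
  by exists 1; rewrite invg1 !mulg1 !generator_square //; split=> //; left.
have [sa1 sa2] := flip _ _ (generator_square Ss) sa.
have [ta1 ta2] := flip _ _ (generator_square St) ta.
move: Sx; rewrite {1}SE => -[] /= ->.
  exists a^-1; rewrite sa2 ta2 sK tK invgK; split=> //.
  by case: wE => ->; [right | left; rewrite mulgA]; rewrite sa1 ?sK.
exists (a^-1 * t * s); rewrite !invgM (generator_inv Ss) (generator_inv St) invgK.
split; last by case: wE => ->; [right; rewrite sK|left; rewrite mulgA]; rewrite ta1.
  by rewrite !mulgA sK -!mulgA ta1.
by rewrite !mulgA ta2 tK -[RHS]mulgA ta1 mulgA sa2.
Qed.

(** The rotation [a] commutes with [s] as [w] does, yet [s] inverts it, so [a = a^-1]; as [t]
    inverts it too, [t] commutes with it. *)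
Lemma commute_central w : w * s = s * w ->
  exists a, [/\ a * s = s * a, a * t = t * a & w = a \/ w = a * s].
Proof.
have Ss : S s by rewrite SE; left.
have St : S t by rewrite SE; right.
have [a [sa ta wE]] := dihedral_form w => ws; exists a.
have as_ : a * s = s * a.
  case: wE ws => -> //; rewrite -mulgA generator_square // mulg1 => {1}->.
  by rewrite -!mulgA generator_square // mulg1.
have aV : a^-1 = a by rewrite -sa -as_ -mulgA generator_square // mulg1.
by split=> //; rewrite -{1}aV -ta -mulgA generator_square // mulg1.
Qed.

(** This covers both cases: for infinite order only [m = 0] occurs, and an even order divides
    [m]. *)
Hypothesis st_even : forall m, (s * t) ^+ m = 1 -> ~~ odd m.

Lemma even_not_conj w : w * t * w^-1 <> s.
Proof.
have Ss : S s by rewrite SE; left.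
have St : S t by rewrite SE; right.
have neq_st : (t == s) = false.
  by apply/eqP => ts; have /= := @st_even 1; rewrite ts generator_square // => /(_ erefl).
(* [c] embeds Z/2 in [twisted W]; mapping [s] to [c true] and [t] to [c false]
   respects the relations because [st] has even or infinite order. *)
pose c (b : bool) : twisted W := (1, fun=> b).
have cM b b' : c b * c b' = c (b (+) b') by rewrite /c; congr pair; rewrite mulg1.
have cX b m : c b ^+ m = c (b && odd m).
  elim: m => [|m IH]; first by rewrite andbF.
  by rewrite expgS IH cM /=; case: b {IH}; case: odd.
have rel x y m : S x -> S y -> has_order (x * y) m ->
    (c (x == s) * c (y == s)) ^+ m = 1.
  rewrite SE => Sx Sy [_ xym _]; rewrite cM cX.
  suff -> : ((x == s) (+) (y == s)) && odd m = false by [].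
  case: Sx Sy xym => -> [] ->; rewrite /= ?eqxx ?neq_st //= => xym.
    exact/negbTE/st_even.
  apply/negbTE/st_even.
  have -> : s * t = (t * s) ^ s.
    by rewrite conjgE generator_inv // -!mulgA generator_square // mulg1.
  by rewrite -conjXg xym conj1g.
have [phi phiS] := coxeter_presented hWS rel.
have phi_t : phi t = 1 by rewrite phiS // neq_st.
move=> wE; have : phi s = 1.
  by rewrite -wE !gmulfM phi_t mulg1 -gmulfM mulgV multiplicative1.
by rewrite phiS // eqxx => /(congr1 (fun a : twisted W => a.2 1)).
Qed.

Lemma nice_dihedral A : A `<=` reflections S ->
  A = [set s; t; s * t * s] \/ A = [set t; s * t * s] -> nice S A.
Proof.
move=> AT AE.
have Ss : S s by rewrite SE; left.
have St : S t by rewrite SE; right.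
have sV := generator_inv Ss; have ss := generator_square Ss.
have At : A t by case: AE => ->; [left; right|left].
have Asts : A (s * t * s) by case: AE => ->; right.
(* [t] and [sts] are conjugate to [t], hence not to [s]. *)
have Aconj q w : A q -> w * q * w^-1 = s -> q = s.
  have Nt := @even_not_conj w; have Nsts := @even_not_conj (w * s).
  have {}Nsts : w * (s * t * s) * w^-1 <> s.
    by move: Nsts; rewrite invgM sV !mulgA.
  by case: AE => ->; [case=> [[]|]|case] => // ->.
(* An element commuting with [s] is central up to a factor [s], so it moves [t]
   only within [{t, sts}]. *)
have At_comm w : w * s = s * w -> A (w^-1 * t * w).
  move=> /commute_central[a [as_ at_ wE]].
  have ta : a^-1 * t * a = t by rewrite -mulgA -at_ mulKg.
  case: wE => ->; rewrite ?ta //.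
  have -> : (a * s)^-1 * t * (a * s) = s * (a^-1 * t * a) * s.
    by rewrite invgM sV !mulgA.
  by rewrite ta.
apply: niceI => // r w q Ar Aq NAr.
have rNy : r <> w * q * w^-1.
  by move=> rE; apply: NAr; rewrite rE !mulgA mulVg mul1g mulgVK.
have eta_simple : S r -> eta r (w * q * w^-1) = false.
  by move=> Sr; rewrite etaS //; apply/eqP => /esym.
have [|rE] : S r \/ r = s * t * s.
  move: Ar; case: AE => ->; [case=> [[]|]|case] => ->; by [left|right].
  exact: eta_simple.
have ys v : v * q * v^-1 = s -> A (v^-1 * t * v).
  move=> qE; apply: At_comm; have := qE; rewrite (Aconj _ _ Aq qE) => {2}<-.
  by rewrite mulgVK.
(* With [y = w q w^-1], three values of [y] are to be excluded: [sts] is [r] itself; for [s] and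
   [ststs], [ys] applies to [v = s w] and [v = (st)^-1 w], each satisfying [v q v^-1 = s] and
   [v^-1 t v = w^-1 r w]. *)
rewrite rE !etaM !etaS // !conjg_eq !sV.
have -> : (w * q * w^-1 == s * t * s) = false.
  by apply/eqP => qE; apply: rNy; rewrite rE qE.
have -> : (w * q * w^-1 == s) = false.
  apply/eqP => qE; apply: NAr.
  have -> : w^-1 * r * w = (s * w)^-1 * t * (s * w).
    by rewrite rE invgM sV !mulgA.
  apply: ys; rewrite invgM sV.
  have -> : s * w * q * (w^-1 * s) = s * (w * q * w^-1) * s by rewrite !mulgA.
  by rewrite qE ss mul1g.
rewrite /=; apply/eqP => qE; apply: NAr.
have -> : w^-1 * r * w = ((s * t)^-1 * w)^-1 * t * ((s * t)^-1 * w).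
  by rewrite rE !invgM !invgK !mulgA mulgK sV.
apply: ys; rewrite (invgM _ w) invgK.
have -> : (s * t)^-1 * w * q * (w^-1 * (s * t)) = (s * t)^-1 * (w * q * w^-1) * (s * t).
  by rewrite !mulgA.
by rewrite qE -mulgA mulgVK mulKg.
Qed.

End Dihedral.
End Cocycle.
End Coxeter.

Unset Implicit Arguments.
Set Strict Implicit.

Theorem theorem1p16 (W : groupType) (S : set W) (A : set W)
  (hWS : coxeter_system S) (finS : finite_set S) (AT : A `<=` reflections S)
  (hA :
    (exists S1 S2 : set W,
       [/\ S1 `<=` S, S2 `<=` S &
           A = S1 `|` \bigcup_(s in S2) conj_class s]) \/
    (exists s t : W,
       [/\ S = [set s; t],
           has_infinite_order (s * t) \/
             (exists m, has_order (s * t) m /\ ~~ odd m) &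
           A = [set s; t; s * t * s] \/ A = [set t; s * t * s]])) :
  nice S A.
Proof.
have [eta [etaS etaM]] := reflection_cocycle hWS.
case: hA => [[S1 [S2 [S1S _ AE]]]|[s [t [SE ord_st AE]]]].
  exact: (nice_conj_classes hWS etaS etaM AT S1S AE).
apply: (nice_dihedral hWS etaS etaM SE _ AT AE) => m stm; case: ord_st => [inf|[d [[d0 std dmin] d_even]]].
  by case: m stm => // m stm; case: (inf m.+1).
suff /dvdnP[k ->] : (d %| m)%N by rewrite oddM negb_and d_even orbT.
rewrite /dvdn -leqn0 leqNgt; apply/negP => r0.
apply: (dmin (m %% d)%N); first by rewrite r0 ltn_pmod.
by move: stm; rewrite {1}(divn_eq m d) expgnDr mulnC expgnA std expg1n mul1g.
Qed.
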